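(* For any integer $n\geq 0$, the identity $$\sum_{k=0}^\infty\frac{\binom{2k}{k}}{2k+2n+1}\Bigl(\frac{x}{2}\Bigr)^{2k} =\frac{\binom{2n}{n}}{(2x)^{2n+1}}\left(2\arcsin x-\sqrt{1-x^2}\cdot\sum_{j=0}^{n-1}\frac{(2x)^{2j+1}}{(2j+1)\binom{2j}{j}}\right)$$ is equivalent to $${}_2F_1\bigl(\tfrac{1}{2},n+\tfrac{1}{2};n+\tfrac{3}{2};x^2\bigr) =\sqrt{1-x^2}\cdot{}_2F_1\bigl(1,n+1;n+\tfrac{3}{2};x^2\bigr),$$ where $x$ is real with $0<|x|<1$.
   Context: ${}_2F_1(a,b;c;z)=\sum_{k=0}^\infty\frac{(a)_k(b)_k}{(c)_k}\frac{z^k}{k!}$ is the Gaussian hypergeometric function, with $(a)_0=1$ and $(a)_k=a(a+1)\cdots(a+k-1)$ for $k\ge1$. Empty sums are equal to $0$. *)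

(* Defs.v *)
(* Classical reals of the standard library, with Coquelicot for series. *)
From Stdlib Require Import Reals Factorial.
From Coquelicot Require Import Coquelicot.
Open Scope R_scope.

Fixpoint pochhammer (a : R) (k : nat) : R :=
  match k with
  | O => 1
  | S j => pochhammer a j * (a + INR j)
  end.

(* [Series] is a total operator: the value is meaningful when the series
   converges, in particular for |z| < 1 and c not in {0, -1, -2, ...}. *)
Definition hyp2F1 (a b c z : R) : R :=
  Series (fun k : nat =>
    pochhammer a k * pochhammer b k / pochhammer c k * (z ^ k / INR (fact k))).

(* f 0 + ... + f (n - 1); [sum_f_R0 f m] has m + 1 terms and cannot express
   the empty sum. *)
Definition sum_lt (f : nat -> R) (n : nat) : R :=
  match n with
  | O => 0
  | S m => sum_f_R0 f m
  end.

(* Coquelicot shadows the name [C] with the type of complex numbers. *)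
Definition binom (n k : nat) : R := Binomial.C n k.

(* Main.v *)
(* Both identities assert the same equation up to the factor [2n + 1]. On the
   left, [binom (2k) k / 4^k = (1/2)_k / k!]. On the right, put
   [a_k = (1)_k / (3/2)_k]; the series [P y = sum a_k y^k] satisfies
   [2 y (1 - y) P' + (1 - 2 y) P = 1], so [sqrt (1 - x^2) * x * P (x^2)] has the
   derivative of [asin x]. The bracket is thus [sqrt (1 - x^2)] times a tail of
   the series of [2 x P (x^2)], and
   [a_(n+k) = a_n (n + 1)_k / (n + 3/2)_k] turns that tail into a 2F1. *)
Require Import Defs.
From Stdlib Require Import Reals Lra Lia Factorial.
From Coquelicot Require Import Coquelicot.
Open Scope R_scope.

Lemma pochhammer_pos (a : R) (k : nat) : 0 < a -> 0 < pochhammer a k.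
Proof.
  intros Ha; induction k as [|k IH]; simpl; [lra|].
  apply Rmult_lt_0_compat; [exact IH|]. pose proof (pos_INR k); lra.
Qed.

Lemma pochhammer_1 (k : nat) : pochhammer 1 k = INR (fact k).
Proof.
  induction k as [|k IH]; [reflexivity|].
  rewrite fact_simpl, mult_INR, S_INR, <- IH; simpl; ring.
Qed.

Lemma pochhammer_add (a : R) (n k : nat) :
  pochhammer a (n + k) = pochhammer a n * pochhammer (a + INR n) k.
Proof.
  induction k as [|k IH]; [rewrite Nat.add_0_r; simpl; ring|].
  rewrite Nat.add_succ_r; simpl. rewrite IH, plus_INR; ring.
Qed.

(** Both sides are [pochhammer a (k + 1)], with the first factor split off on the left and the last
    on the right. *)
Lemma pochhammer_shift (a : R) (k : nat) :
  a * pochhammer (a + 1) k = pochhammer a k * (a + INR k).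
Proof.
  change (pochhammer a k * (a + INR k)) with (pochhammer a (1 + k)).
  rewrite pochhammer_add; simpl; ring.
Qed.

Lemma central_binom (k : nat) :
  binom (2 * k) k = 4 ^ k * pochhammer (1 / 2) k / INR (fact k).
Proof.
  unfold binom, Binomial.C. replace (2 * k - k)%nat with k by lia.
  (* Division-free form for the induction: the even factors of [(2k)!] give [2^k k!], the odd ones
     [2^k (1/2)_k]. *)
  cut (INR (fact (2 * k)) = 4 ^ k * pochhammer (1 / 2) k * INR (fact k)).
  { intros ->. field. apply INR_fact_neq_0. }
  induction k as [|k IH]; [simpl; lra|].
  replace (2 * S k)%nat with (S (S (2 * k))) by lia.
  rewrite !fact_simpl, !mult_INR, IH, !S_INR, mult_INR; simpl; field.
Qed.

(** The [a_k] of the overview: 1, 2/3, 8/15, ..., the coefficients of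
    [asin x / (x * sqrt (1 - x^2))] in powers of [x^2]. *)
Definition asin_coeff (k : nat) : R := pochhammer 1 k / pochhammer (3 / 2) k.

Lemma asin_coeff_S (k : nat) :
  (2 * INR k + 3) * asin_coeff (S k) = (2 * INR k + 2) * asin_coeff k.
Proof.
  unfold asin_coeff; simpl.
  pose proof (pos_INR k). pose proof (pochhammer_pos (3 / 2) k ltac:(lra)).
  field; lra.
Qed.

Lemma asin_coeff_pos (k : nat) : 0 < asin_coeff k.
Proof.
  apply Rdiv_lt_0_compat; apply pochhammer_pos; lra.
Qed.

(** By the recurrence the coefficients decrease from [a_0 = 1]. This bound yields a radius of
    convergence of at least 1. *)
Lemma asin_coeff_le_1 (k : nat) : asin_coeff k <= 1.
Proof.
  induction k as [|k IH]; [unfold asin_coeff; simpl; lra|].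
  pose proof (asin_coeff_S k). pose proof (pos_INR k).
  pose proof (asin_coeff_pos k). nra.
Qed.

Lemma asin_coeff_add (n k : nat) :
  asin_coeff (n + k)
    = asin_coeff n * (pochhammer (INR n + 1) k / pochhammer (INR n + 3 / 2) k).
Proof.
  unfold asin_coeff. rewrite !pochhammer_add, !(Rplus_comm (INR n)).
  pose proof (pos_INR n).
  pose proof (pochhammer_pos (3 / 2) n ltac:(lra)).
  pose proof (pochhammer_pos (3 / 2 + INR n) k ltac:(lra)).
  field; lra.
Qed.

(** Since [(3/2)_k = (2k + 1) (1/2)_k], everything but [4^k] cancels. This identifies the terms of
    the finite sum with those of the power series. *)
Lemma central_binom_asin_coeff (k : nat) :
  INR (2 * k + 1) * binom (2 * k) k * asin_coeff k = 4 ^ k.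
Proof.
  rewrite central_binom. unfold asin_coeff. rewrite <- pochhammer_1.
  pose proof (pochhammer_shift (1 / 2) k) as H.
  replace (1 / 2 + 1) with (3 / 2) in H by lra.
  replace (pochhammer (3 / 2) k)
    with (pochhammer (1 / 2) k * (2 * INR k + 1)) by lra.
  rewrite plus_INR, mult_INR; simpl.
  pose proof (pos_INR k).
  pose proof (pochhammer_pos (1 / 2) k ltac:(lra)).
  pose proof (pochhammer_pos 1 k ltac:(lra)).
  field; lra.
Qed.

Lemma asin_coeff_radius (y : R) :
  Rabs y < 1 -> Rbar_lt (Rabs y) (CV_radius asin_coeff).
Proof.
  intros Hy. apply Rbar_lt_le_trans with (Finite 1); [exact Hy|].
  apply (proj1 (CV_radius_bounded asin_coeff)). exists 1; intros k.
  rewrite pow1, Rmult_1_r, Rabs_pos_eq.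
  - apply asin_coeff_le_1.
  - apply Rlt_le, asin_coeff_pos.
Qed.

(** The recurrence [asin_coeff_S] is, coefficient by coefficient,
    [2 P' + (P - 1) / y = 2 (y P' + P)]; multiplying by [y] gives the equation, also at [y = 0]. *)
Lemma asin_series_ode (y : R) : Rabs y < 1 ->
  2 * y * (1 - y) * PSeries (PS_derive asin_coeff) y
    + (1 - 2 * y) * PSeries asin_coeff y = 1.
Proof.
  intros Hy. pose proof (asin_coeff_radius y Hy) as Hr.
  pose proof (CV_radius_inside _ _ Hr) as Ha.
  pose proof (ex_pseries_derive _ _ Hr) as Hd.
  assert (H : PSeries (PS_plus (PS_scal 2 (PS_derive asin_coeff))
                               (PS_decr_1 asin_coeff)) y
    = PSeries (PS_scal 2 (PS_plus (PS_incr_1 (PS_derive asin_coeff))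
                                  asin_coeff)) y).
  { apply PSeries_ext; intros k.
    unfold PS_plus, PS_scal, PS_decr_1, PS_incr_1, PS_derive.
    pose proof (asin_coeff_S k) as Hk.
    change (2 * (INR (S k) * asin_coeff (S k)) + asin_coeff (S k)
      = 2 * (match k with
             | O => 0
             | S j => INR (S j) * asin_coeff (S j)
             end + asin_coeff k)).
    rewrite S_INR.
    (* For [k = 0] the constant term 0 of the shifted series agrees with [k * a_k]. *)
    destruct k; [change (INR 0) with 0 in *|]; lra. }
  rewrite PSeries_scal, !PSeries_plus, PSeries_scal, PSeries_incr_1 in H.
  - pose proof (PSeries_decr_1 _ _ Ha) as H0.
    replace (asin_coeff 0) with 1 in H0 by (unfold asin_coeff; simpl; lra).
    nra.
  - now apply ex_pseries_incr_1.
  - exact Ha.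
  - apply ex_pseries_scal; [apply Rmult_comm | exact Hd].
  - apply ex_pseries_decr_1; [|exact Ha].
    destruct (Req_dec y 0) as [->|Hy0]; [now left | right].
    exists (/ y). now apply Rinv_l.
Qed.

Lemma is_derive_asin (x : R) :
  -1 < x < 1 -> is_derive asin x (1 / sqrt (1 - x ^ 2)).
Proof.
  intros Hx. apply is_derive_Reals.
  rewrite <- Rsqr_pow2, <- (derive_pt_asin x Hx).
  now apply derive_pt_eq_1 with (derivable_pt_asin x Hx).
Qed.

(** Both sides vanish at 0 and, by the differential equation at [y = t^2], have the same derivative;
    the mean value theorem shows that their difference [g] is constant. *)
Lemma asin_series (x : R) : Rabs x < 1 ->
  asin x = sqrt (1 - x ^ 2) * (x * PSeries asin_coeff (x ^ 2)).
Proof.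
  intros Hx.
  set (g := fun t => sqrt (1 - t ^ 2) * (t * PSeries asin_coeff (t ^ 2)) - asin t).
  assert (Hg : forall t, Rabs t < 1 -> is_derive g t 0).
  { intros t Ht. apply Rabs_def2 in Ht.
    assert (Ht2 : 0 < 1 - t ^ 2) by nra.
    assert (Hy : Rabs (t ^ 2) < 1) by (rewrite Rabs_pos_eq; nra).
    pose proof (asin_series_ode _ Hy) as Hode.
    pose proof (is_derive_PSeries _ _ (asin_coeff_radius _ Hy)) as HP.
    pose proof (is_derive_asin t ltac:(lra)) as Hasin.
    unfold g. auto_derive.
    - repeat split; [lra | eexists; exact HP | eexists; exact Hasin].
    - change (t * (t * 1)) with (t ^ 2).
      change (1 + - t ^ 2) with (1 - t ^ 2).
      replace (Derive _ (t ^ 2)) with (PSeries (PS_derive asin_coeff) (t ^ 2))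
        by (symmetry; exact (is_derive_unique _ _ _ HP)).
      replace (Derive _ t) with (1 / sqrt (1 - t ^ 2))
        by (symmetry; exact (is_derive_unique _ _ _ Hasin)).
      pose proof (sqrt_lt_R0 _ Ht2) as Hs.
      pose proof (sqrt_sqrt _ (Rlt_le _ _ Ht2)) as Hss.
      set (r := sqrt (1 - t ^ 2)) in *.
      set (P := PSeries asin_coeff (t ^ 2)) in *.
      set (P' := PSeries (PS_derive asin_coeff) (t ^ 2)) in *.
      (* Over the common denominator [r], substituting [r * r = 1 - t^2] turns the numerator into
         the differential equation. *)
      transitivity ((r * r * (P + 2 * t ^ 2 * P') - t ^ 2 * P - 1) / r).
      + field; lra.
      + rewrite Hss. replace (_ - 1) with 0 by lra. unfold Rdiv; ring. }
  destruct (MVT_gen g 0 x (fun _ => 0)) as [c [_ Hc]].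
  - intros t Ht. apply Hg. unfold Rmin, Rmax, Rabs in *.
    destruct (Rle_dec 0 x), (Rcase_abs x), (Rcase_abs t); lra.
  - intros t Ht. apply continuity_pt_filterlim.
    apply (ex_derive_continuous g). exists 0. apply Hg. unfold Rmin, Rmax, Rabs in *.
    destruct (Rle_dec 0 x), (Rcase_abs x), (Rcase_abs t); lra.
  - unfold g in Hc. rewrite asin_0 in Hc. lra.
Qed.

(** Termwise, [pochhammer_shift] at [n + 1/2] gives [(2n + 1) / (2k + 2n + 1) = (n + 1/2)_k / (n +
    3/2)_k]. *)
Lemma central_binom_series_hyp2F1 (n : nat) (x : R) :
  Series (fun k : nat =>
      binom (2 * k) k / INR (2 * k + 2 * n + 1) * (x / 2) ^ (2 * k))
    = / INR (2 * n + 1)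
      * hyp2F1 (1 / 2) (INR n + 1 / 2) (INR n + 3 / 2) (x ^ 2).
Proof.
  unfold hyp2F1. rewrite <- Series_scal_l. apply Series_ext; intros k.
  rewrite central_binom, pow_mult.
  replace ((x / 2) ^ 2) with (x ^ 2 * / 4) by field.
  rewrite Rpow_mult_distr, pow_inv, !plus_INR, !mult_INR; simpl (INR 2); simpl (INR 1).
  pose proof (pos_INR n). pose proof (pos_INR k).
  pose proof (pochhammer_pos (INR n + 3 / 2) k ltac:(lra)).
  pose proof (pochhammer_shift (INR n + 1 / 2) k) as Hshift.
  replace (INR n + 1 / 2 + 1) with (INR n + 3 / 2) in Hshift by lra.
  replace (pochhammer (INR n + 1 / 2) k)
    with ((INR n + 1 / 2) * pochhammer (INR n + 3 / 2) k
          / (INR n + 1 / 2 + INR k)) by (rewrite Hshift; field; lra).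
  pose proof (INR_fact_neq_0 k). pose proof (pow_nonzero 4 k ltac:(lra)).
  field; repeat split; lra.
Qed.

Lemma hyp2F1_1_l (b c z : R) :
  hyp2F1 1 b c z = Series (fun k => pochhammer b k / pochhammer c k * z ^ k).
Proof.
  apply Series_ext; intros k. rewrite pochhammer_1.
  (* As [c] is arbitrary, [pochhammer c k] may vanish; its inverse is made opaque so that [field]
     does not ask for it to be nonzero. *)
  unfold Rdiv. generalize (/ pochhammer c k); intros d.
  field. apply INR_fact_neq_0.
Qed.

Lemma PSeries_tail (a : nat -> R) (y : R) (n : nat) : ex_pseries a y ->
  PSeries a y = sum_lt (fun j => a j * y ^ j) n
                + Series (fun k => a (n + k)%nat * y ^ (n + k)).
Proof.
  (* The empty sum is separate because [Series_incr_n] requires a positive index. *)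
  intros Ha. destruct n as [|n]; [simpl; now rewrite Rplus_0_l|].
  apply (Series_incr_n (fun j => a j * y ^ j) (S n)); [lia|].
  now apply ex_pseries_R.
Qed.

Lemma sum_lt_ext (f g : nat -> R) (n : nat) :
  (forall j, f j = g j) -> sum_lt f n = sum_lt g n.
Proof.
  intros H. destruct n; [reflexivity|]. apply sum_eq; auto.
Qed.

Lemma sum_lt_scal (c : R) (f : nat -> R) (n : nat) :
  sum_lt (fun j => c * f j) n = c * sum_lt f n.
Proof.
  destruct n; simpl; [ring|]. rewrite scal_sum.
  apply sum_eq; intros; ring.
Qed.

(** The tail carries the factor [a_n x^(2n)]; together with the prefactor it collapses, as
    [binom (2n) n * a_n / 4^n = 1 / (2n + 1)]. *)
Lemma asin_remainder_hyp2F1 (n : nat) (x : R) :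
  x <> 0 -> Rabs x < 1 ->
  binom (2 * n) n / (2 * x) ^ (2 * n + 1)
      * (2 * asin x
         - sqrt (1 - x ^ 2)
           * sum_lt (fun j : nat =>
               (2 * x) ^ (2 * j + 1) / (INR (2 * j + 1) * binom (2 * j) j)) n)
    = / INR (2 * n + 1)
      * (sqrt (1 - x ^ 2) * hyp2F1 1 (INR n + 1) (INR n + 3 / 2) (x ^ 2)).
Proof.
  intros Hx0 Hx1. rewrite (asin_series x Hx1).
  rewrite (sum_lt_ext _ (fun j => 2 * x * (asin_coeff j * (x ^ 2) ^ j))).
  2:{ intros j. pose proof (central_binom_asin_coeff j) as Hj.
      rewrite Rpow_mult_distr, !pow_add, !pow_mult, !pow_1.
      replace (2 ^ 2) with 4 by ring. rewrite <- Hj.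
      (* The denominators are nonzero because they divide the product [Hj], which equals
         [4^j > 0]. *)
      pose proof (pow_lt 4 j ltac:(lra)).
      field; split; intros H0; rewrite H0 in Hj; lra. }
  rewrite sum_lt_scal, hyp2F1_1_l.
  assert (Hy : Rabs (x ^ 2) < 1).
  { apply Rabs_def2 in Hx1. rewrite Rabs_pos_eq; nra. }
  rewrite (PSeries_tail _ _ n (CV_radius_inside _ _ (asin_coeff_radius _ Hy))).
  rewrite (Series_ext _ (fun k => asin_coeff n * (x ^ 2) ^ n
    * (pochhammer (INR n + 1) k / pochhammer (INR n + 3 / 2) k * (x ^ 2) ^ k))).
  2:{ intros k. rewrite asin_coeff_add, pow_add; ring. }
  rewrite Series_scal_l, Rpow_mult_distr, !pow_add, !pow_mult, !pow_1.
  replace (2 ^ 2) with 4 by ring. rewrite <- (central_binom_asin_coeff n).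
  pose proof (pow_lt 4 n ltac:(lra)) as H4.
  rewrite <- (central_binom_asin_coeff n) in H4.
  pose proof (pow_nonzero (x ^ 2) n ltac:(nra)).
  field; repeat split; try assumption; intros H0; rewrite H0 in H4; lra.
Qed.

Theorem corollary9p1 (n : nat) (x : R) (hx0 : 0 < Rabs x) (hx1 : Rabs x < 1) :
  Series (fun k : nat =>
      binom (2 * k) k / INR (2 * k + 2 * n + 1) * (x / 2) ^ (2 * k))
    = binom (2 * n) n / (2 * x) ^ (2 * n + 1)
      * (2 * asin x
         - sqrt (1 - x ^ 2)
           * sum_lt (fun j : nat =>
               (2 * x) ^ (2 * j + 1) / (INR (2 * j + 1) * binom (2 * j) j)) n)
  <->
  hyp2F1 (1 / 2) (INR n + 1 / 2) (INR n + 3 / 2) (x ^ 2)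
    = sqrt (1 - x ^ 2) * hyp2F1 1 (INR n + 1) (INR n + 3 / 2) (x ^ 2).
Proof.
  assert (Hx : x <> 0) by (intros ->; rewrite Rabs_R0 in hx0; lra).
  rewrite central_binom_series_hyp2F1, (asin_remainder_hyp2F1 n x Hx hx1).
  split; [intros H | now intros ->].
  apply Rmult_eq_reg_l in H; [exact H|].
  apply Rinv_neq_0_compat, not_0_INR. lia.
Qed.
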